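(* Let $n\ge1$ and let $b\in\Delta_n$ satisfy $b^2=e_n$. Then, for $r=0,1,2$, $$\Sigma_{+}(b)\,\gamma^r(\Sigma_{-}(b))=0,\qquad \gamma^r(\Sigma_{-}(b))\,\Sigma_{+}(b)=0.$$
   Context: $\Delta_n=\{1,2,4,7\}^n$ is the set of words of length $n$, and $e_n=77\cdots7$. Digits are identified with quaternionic symbols: $1=i$, $2=j$, $4=k$, $7=e$, where $e$ is the identity, $i^2=j^2=k^2=-e$, $ij=k=-ji$, $jk=i=-kj$, $ki=j=-ik$. Words are multiplied coordinate by coordinate, with the local quaternionic signs collected into one global sign, so that products lie in $\Delta_n\sqcup(-\Delta_n)$. $\mathcal A_n$ is the real algebra with basis $\Delta_n$ and product extended bilinearly (so $\mathcal A_n\cong\mathbb H^{\otimes n}$). $\gamma$ acts on words by applying $1\mapsto2\mapsto4\mapsto1$, $7\mapsto7$ in every coordinate, and is extended linearly to $\mathcal A_n$. For $b\in\Delta_n$, $C_{+}(b)=\{c\in\Delta_n:cb=bc\text{ and }cb\in\Delta_n\}$, $C_{-}(b)=\{c\in\Delta_n:cb=bc\text{ and }cb\in-\Delta_n\}$, and $\Sigma_{\pm}(b)=\sum_{c\in C_{\pm}(b)}c\in\mathcal A_n$ (an empty sum being $0$). *)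

(* Defs.v *)
From HB Require Import structures.
From mathcomp Require Import all_boot all_order all_algebra.
From mathcomp Require Import reals.

Set Implicit Arguments.
Unset Strict Implicit.
Unset Printing Implicit Defensive.

Import GRing.Theory.
Local Open Scope ring_scope.

(* The digits 1, 2, 4, 7 stand for the quaternions i, j, k, e. *)
Inductive digit := D1 | D2 | D4 | D7.

Definition ord_of_digit (d : digit) : 'I_4 :=
  match d with D1 => inord 0 | D2 => inord 1 | D4 => inord 2 | D7 => inord 3 end.

Definition digit_of_ord (i : 'I_4) : digit :=
  match val i with 0 => D1 | 1 => D2 | 2 => D4 | _ => D7 end.

Fact ord_of_digitK : cancel ord_of_digit digit_of_ord.
Proof. by case; rewrite /digit_of_ord /= inordK. Qed.

HB.instance Definition _ := Finite.copy digit (can_type ord_of_digitK).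

(* A signed element is a pair (s, x) with s = true exactly when the sign is
   negative, so that (false, x) encodes x and (true, x) encodes -x. *)
Definition digit_mul (x y : digit) : bool * digit :=
  match x, y with
  | D7, d | d, D7 => (false, d)
  | D1, D1 | D2, D2 | D4, D4 => (true, D7)
  | D1, D2 => (false, D4) | D2, D1 => (true, D4)
  | D2, D4 => (false, D1) | D4, D2 => (true, D1)
  | D4, D1 => (false, D2) | D1, D4 => (true, D2)
  end.

Definition digit_rot (x : digit) : digit :=
  match x with D1 => D2 | D2 => D4 | D4 => D1 | D7 => D7 end.

Definition word (n : nat) := {ffun 'I_n -> digit}.

HB.instance Definition _ n := Finite.on (word n).

Definition signed_word (n : nat) : Type := (bool * word n)%type.

HB.instance Definition _ n := Finite.on (signed_word n).

Definition word_e (n : nat) : word n := [ffun => D7].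

Definition word_mul n (x y : word n) : signed_word n :=
  (\big[addb/false]_(i < n) (digit_mul (x i) (y i)).1,
   [ffun i => (digit_mul (x i) (y i)).2]).

Definition word_rot n (x : word n) : word n := [ffun i => digit_rot (x i)].

Definition pos_word n (p : signed_word n) : bool := ~~ p.1.
Definition neg_word n (p : signed_word n) : bool := p.1.

Definition Cplus n (b : word n) : {set word n} :=
  [set c | (word_mul c b == word_mul b c) && pos_word (word_mul c b)].

Definition Cminus n (b : word n) : {set word n} :=
  [set c | (word_mul c b == word_mul b c) && neg_word (word_mul c b)].

(* Elements are coefficient functions on the words.  The name hides the finite
   function type on purpose: MathComp equips the latter with the pointwise
   product, which is not the one wanted here. *)
Definition word_alg (R : realType) (n : nat) : Type := {ffun word n -> R^o}.

Section WordAlgebra.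
Variables (R : realType) (n : nat).

HB.instance Definition _ :=
  GRing.Lmodule.copy (word_alg R n) {ffun word n -> R^o}.

Local Notation A := (word_alg R n).
Implicit Types (x y z : A) (u v w : word n).

Definition coef x w : R := (x : {ffun word n -> R^o}) w.

Definition basis w : A := [ffun w' => (w' == w)%:R] : {ffun word n -> R^o}.

Definition signed_basis (p : signed_word n) : A := (-1) ^+ p.1 *: basis p.2.

Definition alg_mul x y : A :=
  \sum_(u : word n) \sum_(v : word n)
    (coef x u * coef y v) *: signed_basis (word_mul u v).

Definition gamma x : A := \sum_(u : word n) coef x u *: basis (word_rot u).

Definition Sigma_plus (b : word n) : A := \sum_(c in Cplus b) basis c.
Definition Sigma_minus (b : word n) : A := \sum_(c in Cminus b) basis c.

Fact coef_lin a x y w : coef (a *: x + y) w = a * coef x w + coef y w.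
Proof. by rewrite /coef /= !ffunE. Qed.

Fact coefZ a x w : coef (a *: x) w = a * coef x w.
Proof. by rewrite /coef /= !ffunE. Qed.

Fact coef_basis u w : coef (basis u) w = (w == u)%:R.
Proof. by rewrite /coef ffunE. Qed.

Fact coef_sum (I : Type) (r : seq I) (P : pred I) (F : I -> A) w :
  coef (\sum_(i <- r | P i) F i) w = \sum_(i <- r | P i) coef (F i) w.
Proof. exact: sum_ffunE. Qed.

Fact alg_ext x y : (forall w, coef x w = coef y w) -> x = y.
Proof. by move=> h; apply/ffunP. Qed.

Fact alg_decomp x : x = \sum_(u : word n) coef x u *: basis u.
Proof.
apply: alg_ext => w; rewrite coef_sum (bigD1 w) //= big1 ?addr0.
  by rewrite coefZ coef_basis eqxx mulr1.
by move=> u /negPf uw; rewrite coefZ coef_basis eq_sym uw mulr0.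
Qed.

Fact gamma_linear : linear gamma.
Proof.
move=> a x y; rewrite /gamma scaler_sumr -big_split; apply: eq_bigr => u _ /=.
by rewrite coef_lin scalerDl scalerA.
Qed.

HB.instance Definition _ := GRing.isLinear.Build R A A _ gamma gamma_linear.

Fact alg_mul_linl y : linear (alg_mul^~ y).
Proof.
move=> a x x'; rewrite /alg_mul scaler_sumr -big_split; apply: eq_bigr => u _.
rewrite scaler_sumr -big_split; apply: eq_bigr => v _ /=.
by rewrite coef_lin mulrDl scalerDl [in RHS]scalerA mulrA.
Qed.

Fact alg_mul_linr x : linear (alg_mul x).
Proof.
move=> a y y'; rewrite /alg_mul scaler_sumr -big_split; apply: eq_bigr => u _.
rewrite scaler_sumr -big_split; apply: eq_bigr => v _ /=.
by rewrite coef_lin mulrDr scalerDl [in RHS]scalerA mulrCA.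
Qed.

Let mull y : A -> A := alg_mul^~ y.
HB.instance Definition _ y :=
  GRing.isLinear.Build R A A _ (mull y) (alg_mul_linl y).
Let mulr x : A -> A := alg_mul x.
HB.instance Definition _ x :=
  GRing.isLinear.Build R A A _ (mulr x) (alg_mul_linr x).

Fact alg_mul_suml (I : Type) (r : seq I) (a : I -> R) (F : I -> A) y :
  alg_mul (\sum_(i <- r) a i *: F i) y = \sum_(i <- r) a i *: alg_mul (F i) y.
Proof.
rewrite -/(mull y _) linear_sum.
by apply: eq_bigr => i _; rewrite linearZ.
Qed.

Fact alg_mul_sumr (I : Type) (r : seq I) (a : I -> R) (F : I -> A) x :
  alg_mul x (\sum_(i <- r) a i *: F i) = \sum_(i <- r) a i *: alg_mul x (F i).
Proof.
rewrite -/(mulr x _) linear_sum.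
by apply: eq_bigr => i _; rewrite linearZ.
Qed.

Fact alg_mulZl a x y : alg_mul (a *: x) y = a *: alg_mul x y.
Proof. by rewrite -/(mull y _) linearZ. Qed.

Fact alg_mulZr a x y : alg_mul x (a *: y) = a *: alg_mul x y.
Proof. by rewrite -/(mulr x _) linearZ. Qed.

Fact alg_mul_basis u v :
  alg_mul (basis u) (basis v) = signed_basis (word_mul u v).
Proof.
rewrite /alg_mul (bigD1 u) //= (bigD1 v) //= !coef_basis !eqxx mulr1 scale1r.
rewrite big1 ?addr0 => [|w /negPf wv]; last first.
  by rewrite !coef_basis wv mulr0 scale0r.
rewrite big1 ?addr0 // => w /negPf wu.
by rewrite big1 // => w' _; rewrite !coef_basis wu mul0r scale0r.
Qed.

Fact alg_mul_basisA u v w :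
  alg_mul (basis u) (alg_mul (basis v) (basis w)) =
  alg_mul (alg_mul (basis u) (basis v)) (basis w).
Proof.
rewrite !alg_mul_basis /signed_basis /= alg_mulZl alg_mulZr !alg_mul_basis.
rewrite /signed_basis /= !scalerA -!signr_addb -!big_split /=.
congr ((-1) ^+ nat_of_bool _ *: basis _).
  by apply: eq_bigr => i _; rewrite !ffunE; case: (u i); case: (v i); case: (w i).
by apply/ffunP => i; rewrite !ffunE; case: (u i); case: (v i); case: (w i).
Qed.

Fact alg_mulA : associative alg_mul.
Proof.
move=> x y z; rewrite (alg_decomp x) !alg_mul_suml.
apply: eq_bigr => u _; congr (_ *: _).
rewrite (alg_decomp y) alg_mul_suml !alg_mul_sumr alg_mul_suml.
apply: eq_bigr => v _; congr (_ *: _).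
rewrite (alg_decomp z) !alg_mul_sumr.
by apply: eq_bigr => w _; rewrite alg_mul_basisA.
Qed.

Fact word_mul_el w : word_mul (word_e n) w = (false, w).
Proof.
congr pair; first by rewrite big1 // => i _; rewrite ffunE.
by apply/ffunP => i; rewrite !ffunE.
Qed.

Fact word_mul_er w : word_mul w (word_e n) = (false, w).
Proof.
congr pair; first by rewrite big1 // => i _; rewrite ffunE; case: (w i).
by apply/ffunP => i; rewrite !ffunE; case: (w i).
Qed.

Fact alg_mul1l : left_id (basis (word_e n)) alg_mul.
Proof.
move=> x; rewrite {1}(alg_decomp x) alg_mul_sumr {2}(alg_decomp x).
by apply: eq_bigr => u _; rewrite alg_mul_basis word_mul_el /signed_basis scale1r.
Qed.

Fact alg_mul1r : right_id (basis (word_e n)) alg_mul.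
Proof.
move=> x; rewrite {1}(alg_decomp x) alg_mul_suml {2}(alg_decomp x).
by apply: eq_bigr => u _; rewrite alg_mul_basis word_mul_er /signed_basis scale1r.
Qed.

Fact alg_mulDl : left_distributive alg_mul +%R.
Proof. by move=> x y z; rewrite -/(mull z _) linearD. Qed.

Fact alg_mulDr : right_distributive alg_mul +%R.
Proof. by move=> x y z; rewrite -/(mulr x _) linearD. Qed.

Fact alg_one_neq0 : basis (word_e n) != 0.
Proof.
apply/eqP => /(congr1 (coef^~ (word_e n))); rewrite coef_basis eqxx /coef ffunE.
by move/eqP; rewrite oner_eq0.
Qed.

HB.instance Definition _ := GRing.Zmodule_isNzRing.Build A
  alg_mulA alg_mul1l alg_mul1r alg_mulDl alg_mulDr alg_one_neq0.
HB.instance Definition _ := GRing.Lmodule_isLalgebra.Build R A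
  (fun a x y => esym (alg_mulZl a x y)).
HB.instance Definition _ := GRing.Lalgebra_isAlgebra.Build R A
  (fun a x y => esym (alg_mulZr a x y)).

End WordAlgebra.

(* Main.v *)
Require Import Defs.
From mathcomp Require Import all_boot all_order all_algebra.
From mathcomp Require Import reals.
Import GRing.Theory.
Local Open Scope ring_scope.

(** Membership of [c] in [C_+(b)] says that [cb] and [bc] both carry the sign
    [+].  The signs of [cb] and [bc], together with their product (the commutation
    sign), are permuted when [b] is replaced by [gamma b]; hence
    [C_+(gamma b) = C_+(b)].  As [gamma] sends [Sigma_-(b)] to
    [Sigma_-(gamma b)], this reduces the theorem to [r = 0].  There [b] acts by
    [+1] on [Sigma_+(b)] and by [-1] on [Sigma_-(b)], so both products equal
    their own opposite. *)

Lemma lmod_eqN (F : numFieldType) (V : lmodType F) (x : V) : x = - x -> x = 0.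
Proof.
move=> xN; apply: (@scalerI _ _ 2); first by rewrite Num.Theory.pnatr_eq0.
by rewrite scaler0 scaler_nat mulr2n {2}xN subrr.
Qed.

Section Words.
Variable n : nat.
Implicit Types b c : word n.

(** Up to sign the digits form the Klein four-group, so [cb] and [bc] always have the same
    underlying word; commuting only means that their signs agree. *)
Lemma CplusE b c : (c \in Cplus b) = ~~ (word_mul c b).1 && ~~ (word_mul b c).1.
Proof.
have e2 : (word_mul c b).2 = (word_mul b c).2.
  by apply/ffunP => i; rewrite !ffunE; case: (b i); case: (c i).
rewrite inE -pair_eqE /pair_eq e2 eqxx andbT /pos_word.
by case: (word_mul c b).1; case: (word_mul b c).1.
Qed.

Lemma CminusE b c : (c \in Cminus b) = (word_mul c b).1 && (word_mul b c).1.
Proof.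
have e2 : (word_mul c b).2 = (word_mul b c).2.
  by apply/ffunP => i; rewrite !ffunE; case: (b i); case: (c i).
rewrite inE -pair_eqE /pair_eq e2 eqxx andbT /neg_word.
by case: (word_mul c b).1; case: (word_mul b c).1.
Qed.

Lemma word_mul_rot b c :
  word_mul (word_rot b) (word_rot c) =
  ((word_mul b c).1, word_rot (word_mul b c).2).
Proof.
congr pair; last by apply/ffunP => i; rewrite !ffunE; case: (b i); case: (c i).
by apply: eq_bigr => i _; rewrite !ffunE; case: (b i); case: (c i).
Qed.

Lemma word_rot_e : word_rot (word_e n) = word_e n.
Proof. by apply/ffunP => i; rewrite !ffunE. Qed.

Lemma word_rotK b : word_rot (word_rot (word_rot b)) = b.
Proof. by apply/ffunP => i; rewrite !ffunE; case: (b i). Qed.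

(** With [s], [t] in F_2 the signs of [cb] and [bc], rotating [b] turns [(s, t)] into [(s + t, s)],
    digit by digit. This linear map is invertible, so only [(0, 0)] is sent to [(0, 0)]. *)
Lemma Cplus_rot b : Cplus (word_rot b) = Cplus b.
Proof.
apply/setP => c; rewrite !CplusE.
have -> : (word_mul c (word_rot b)).1 = (word_mul c b).1 (+) (word_mul b c).1.
  rewrite -big_split /=; apply: eq_bigr => i _.
  by rewrite !ffunE; case: (b i); case: (c i).
have -> : (word_mul (word_rot b) c).1 = (word_mul c b).1.
  by apply: eq_bigr => i _; rewrite !ffunE; case: (b i); case: (c i).
by case: (word_mul c b).1; case: (word_mul b c).1.
Qed.

Lemma mem_Cminus_rot b c :
  (word_rot c \in Cminus (word_rot b)) = (c \in Cminus b).
Proof. by rewrite !CminusE !word_mul_rot. Qed.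

Lemma word_mul2K b : involutive (fun c => (word_mul b c).2).
Proof. by move=> c; apply/ffunP => i; rewrite !ffunE; case: (b i); case: (c i). Qed.

(** Associativity [b(bc) = (bb)c], read on signs: [bb] is [e] up to sign, so the last product adds
    none. *)
Lemma word_sgn_mull b c :
  (word_mul b (word_mul b c).2).1 = (word_mul b b).1 (+) (word_mul b c).1.
Proof.
rewrite -big_split /=; apply: eq_bigr => i _.
by rewrite !ffunE; case: (b i); case: (c i).
Qed.

(** The same for [(cb)b = c(bb)], as [bc] and [cb] share their underlying word. *)
Lemma word_sgn_mulr b c :
  (word_mul (word_mul b c).2 b).1 = (word_mul b b).1 (+) (word_mul c b).1.
Proof.
rewrite -big_split /=; apply: eq_bigr => i _.
by rewrite !ffunE; case: (b i); case: (c i).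
Qed.

End Words.

Section Sigma.
Variables (R : realType) (n : nat).
Implicit Types b c : word n.

Lemma gamma_basis b : gamma (basis R b) = basis R (word_rot b).
Proof.
rewrite /gamma (bigD1 b) //= coef_basis eqxx scale1r big1 ?addr0 // => u /negPf ub.
by rewrite coef_basis ub scale0r.
Qed.

Lemma Sigma_plus_rot b : Sigma_plus R (word_rot b) = Sigma_plus R b.
Proof. by rewrite /Sigma_plus Cplus_rot. Qed.

Lemma gamma_Sigma_minus b :
  gamma (Sigma_minus R b) = Sigma_minus R (word_rot b).
Proof.
rewrite [RHS](reindex (@word_rot n)) /=; last first.
  (* The rotation has order three, so its square is its inverse. *)
  by exists (fun c => word_rot (word_rot c)) => c _; apply: word_rotK.
rewrite linear_sum; apply: eq_big => c; first by rewrite mem_Cminus_rot.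
by move=> _; apply: gamma_basis.
Qed.

Lemma basisM b c : basis R b * basis R c = signed_basis R (word_mul b c).
Proof. exact: alg_mul_basis. Qed.

Lemma comm_basis_Sigma_plus b : GRing.comm (basis R b) (Sigma_plus R b).
Proof.
apply: commr_sum => c; rewrite inE => /andP[/eqP e _].
by rewrite /GRing.comm !basisM e.
Qed.

Lemma comm_basis_Sigma_minus b : GRing.comm (basis R b) (Sigma_minus R b).
Proof.
apply: commr_sum => c; rewrite inE => /andP[/eqP e _].
by rewrite /GRing.comm !basisM e.
Qed.

Section Involution.
Variable b : word n.
Hypothesis b2 : word_mul b b = (false, word_e n).

(** As [b] squares to [e], the involution sending [c] to the underlying word of [bc] preserves both
    signs, hence permutes [Cplus b]. *)
Lemma basis_Sigma_plus : basis R b * Sigma_plus R b = Sigma_plus R b.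
Proof.
rewrite mulr_sumr [RHS](reindex_inj (inv_inj (word_mul2K _ b))) /=.
apply: eq_big => c.
  by rewrite !CplusE word_sgn_mull word_sgn_mulr b2.
by rewrite CplusE basisM /signed_basis => /andP[_ /negPf ->]; rewrite scale1r.
Qed.

Lemma basis_Sigma_minus : basis R b * Sigma_minus R b = - Sigma_minus R b.
Proof.
rewrite mulr_sumr -sumrN [RHS](reindex_inj (inv_inj (word_mul2K _ b))) /=.
apply: eq_big => c.
  by rewrite !CminusE word_sgn_mull word_sgn_mulr b2.
(* On [Cminus b] the product [bc] is minus its underlying word, whence the global sign. *)
by rewrite CminusE basisM /signed_basis => /andP[_ ->]; rewrite scaleN1r.
Qed.

Lemma Sigma_plus_minus : Sigma_plus R b * Sigma_minus R b = 0.
Proof.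
apply: (lmod_eqN R).
(* Insert [b] on the left of the first factor, commute it past that factor, and let the second
   factor absorb it with sign -1. *)
by rewrite -{1}basis_Sigma_plus comm_basis_Sigma_plus -mulrA basis_Sigma_minus mulrN.
Qed.

Lemma Sigma_minus_plus : Sigma_minus R b * Sigma_plus R b = 0.
Proof.
apply: (lmod_eqN R).
by rewrite -{1}basis_Sigma_plus mulrA -comm_basis_Sigma_minus basis_Sigma_minus mulNr.
Qed.

End Involution.
End Sigma.

Theorem corollary6p20 (R : realType) (n : nat) (n_ge1 : (1 <= n)%N)
    (b : word n) (b2 : word_mul b b = (false, word_e n))
    (r : nat) (r_le2 : (r <= 2)%N) :
  Sigma_plus R b * iter r (@gamma R n) (Sigma_minus R b) = 0
  /\ iter r (@gamma R n) (Sigma_minus R b) * Sigma_plus R b = 0.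
Proof.
(* [b] stays general in the induction: each [gamma] is traded for a rotation of [b], which still
   squares to [e]. *)
clear r_le2; elim: r b b2 => [|r IHr] b b2.
  by split; [apply: Sigma_plus_minus | apply: Sigma_minus_plus].
rewrite iterSr gamma_Sigma_minus -Sigma_plus_rot.
by apply: IHr; rewrite word_mul_rot b2 /= word_rot_e.
Qed.
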